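(* Consider the Lur'e-type system of the context under the standing compactness assumption. Suppose there exist $P\succ0$ (symmetric, $n\times n$), a diagonal $\Lambda\succ0$ (for which, together with $\Gamma$, the incremental sector condition of the context holds), $q>0$, and matrices $K,K',E\in\mathbb{R}^{n\times n_y}$ such that $$\mathcal M:=\begin{pmatrix}M_{11}&M_{12}\\ M_{12}^\top&M_{22}\end{pmatrix}\preceq0,$$ where $$M_{11}=\mathrm{He}\{P(A_{K'}-KC)\}+qI,\quad M_{12}=PW_{K'}+(I-EC)^\top\Gamma\Lambda,\quad M_{22}=-2\Lambda,$$ with $A_{K'}=(I-K'C)A$ and $W_{K'}=(I-K'C)W$. Consider the noise-free case ($\nu\equiv0$, $p\equiv0$) and the observer $$\begin{cases}\dot{\hat z}_{1,j}=\hat z_{2,j}+[CBu]_j+L_jk_1\lceil y_j-\hat z_{1,j}\rfloor^{1/2},\\ \dot{\hat z}_{2,j}\in L_j^2k_2\,\mathrm{sign}(y_j-\hat z_{1,j}),\qquad j=1,\dots,n_y,\\ \dot{\hat x}=A\hat x+Wf(\hat\zeta)+K(y-C\hat x)-K'\bigl(CA\hat x+CWf(\hat\zeta)-\hat z_2\bigr)+Bu,\end{cases}$$ with $\hat\zeta=\hat x+E(y-C\hat x)$. Then there exist $k_1,k_2>0$ and thresholds $L_j^*\ge1$ ($j=1,\dots,n_y$), those of the homogeneous observer $(\hat z_1,\hat z_2)$, such that for any $L_j\ge L_j^*$ there is a finite reconstruction time $T_0>0$, meaning that $\hat z_2(t)=CAx(t)+CWf(x(t))$ for all $t\ge T_0$,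 and the error $e(t)=\hat x(t)-x(t)$ satisfies $$\|e(t)\|\le\kappa_P\,e^{-\rho(t-T_0)}\|e(T_0)\|\qquad\text{for all }t\ge T_0,$$ with $\kappa_P=\sqrt{\lambda_{\max}(P)/\lambda_{\min}(P)}$ and $\rho=q/(2\lambda_{\max}(P))$.
   Context: System: $\dot x=Ax+Wf(x)+Bu+p(t)$, $y=Cx+\nu(t)$, with state $x\in\mathbb{R}^n$, input $u\in\mathbb{R}^{n_u}$, measured output $y\in\mathbb{R}^{n_y}$, known matrices $A,W\in\mathbb{R}^{n\times n}$, $B\in\mathbb{R}^{n\times n_u}$, $C\in\mathbb{R}^{n_y\times n}$, and disturbances $p,\nu$ (zero in the noise-free case). The nonlinearity $f:\mathbb{R}^n\to\mathbb{R}^n$ is $C^1$ and Lipschitz continuous. Incremental sector condition: with diagonal $\Gamma=\mathrm{diag}(\gamma_1,\dots,\gamma_n)\succeq0$ and $\Lambda=\mathrm{diag}(\lambda_1,\dots,\lambda_n)\succ0$, for all $x,\hat x\in\mathbb{R}^n$, setting $\delta=f(\hat x)-f(x)$ and $e=\hat x-x$, one has $\sum_{i=1}^n\lambda_i\delta_i(\delta_i-\gamma_ie_i)\le0$. Standing compactness assumption: the input $u$ belongs to $L^2([0,\infty),\mathbb{R}^{n_u})$, and the solutions of the system remain in a known compact set $\mathcal K\subset\mathbb{R}^n$ for all inputs $u$ under consideration. Notation: $\mathrm{He}\{X\}=X+X^\top$; $[v]_j$ is the $j$-th component of $v$; $\lceil s\rfloor^{1/2}=|s|^{1/2}\mathrm{sign}(s)$;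 $\|\cdot\|$ is the Euclidean norm; $\hat z_i=(\hat z_{i,1},\dots,\hat z_{i,n_y})^\top$. The differential inclusion is understood in the Filippov sense ($\mathrm{sign}(0)=[-1,1]$).
   Formalization: The inputs under consideration are additionally assumed uniformly essentially bounded on [0,∞), besides being in L²; for unbounded L² inputs the reconstruction claim is false. *)

(* Defs.v *)
(* MathComp-Analysis; [R : realType] are the real numbers. *)
From HB Require Import structures.
From mathcomp Require Import all_boot all_order all_algebra.
From mathcomp Require Import all_classical all_reals all_analysis.

Set Implicit Arguments.
Unset Strict Implicit.
Unset Printing Implicit Defensive.

Import Order.TTheory GRing.Theory Num.Theory.
Import numFieldNormedType.Exports.

Local Open Scope classical_set_scope.
Local Open Scope ring_scope.

(* The library norm on matrices is the sup norm, hence the Euclidean one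
   here. *)
Definition enorm (R : realType) (m : nat) (v : 'cV[R]_m) : R :=
  Num.sqrt (\sum_(i < m) v i ord0 ^+ 2).

Definition psd (R : realType) (m : nat) (X : 'M[R]_m) : Prop :=
  X^T = X /\ forall v : 'cV[R]_m, 0 <= (v^T *m X *m v) ord0 ord0.

Definition pd (R : realType) (m : nat) (X : 'M[R]_m) : Prop :=
  X^T = X /\ forall v : 'cV[R]_m, v != 0 -> 0 < (v^T *m X *m v) ord0 ord0.

Definition nsd (R : realType) (m : nat) (X : 'M[R]_m) : Prop := psd (- X).

Definition He (R : realType) (m : nat) (X : 'M[R]_m) : 'M[R]_m := X + X^T.

(* Only used for symmetric matrices of positive size, whose spectrum is real,
   finite and nonempty. *)
Definition lambda_max (R : realType) (m : nat) (X : 'M[R]_m) : R :=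
  sup [set a : R | eigenvalue X a].
Definition lambda_min (R : realType) (m : nat) (X : 'M[R]_m) : R :=
  inf [set a : R | eigenvalue X a].

Definition C1 (R : realType) (n : nat) (f : 'cV[R]_n -> 'cV[R]_n) : Prop :=
  (forall x, differentiable f x) /\
  (forall v : 'cV[R]_n, continuous (fun x => 'D_v f x)).

Definition incremental_sector (R : realType) (n : nat)
    (f : 'cV[R]_n -> 'cV[R]_n) (gamma lambda : 'rV[R]_n) : Prop :=
  forall x xh : 'cV[R]_n,
    let delta := f xh - f x in
    let e := xh - x in
    \sum_(i < n) lambda ord0 i * delta i ord0 *
      (delta i ord0 - gamma ord0 i * e i ord0) <= 0.

Definition L2_input (R : realType) (m : nat) (u : R -> 'cV[R]_m) : Prop :=
  (forall i, measurable_fun (`[0, +oo[ : set R) (fun t : R => u t i ord0)) /\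
  (@lebesgue_measure R).-integrable `[0, +oo[
    (fun t => (enorm (u t) ^+ 2)%:E).

(* [x] is locally absolutely continuous on [0, +oo) with [x' = v] almost
   everywhere, in the equivalent integral form. *)
Definition primitive (R : realType) (m : nat) (x v : R -> 'cV[R]_m) : Prop :=
  forall (i : 'I_m) (t : R), 0 <= t ->
    (@lebesgue_measure R).-integrable `[0, t]
      (fun s => (v s i ord0)%:E) /\
    x t i ord0 = x 0 i ord0 +
      Rintegral (@lebesgue_measure R) `[0, t] (fun s => v s i ord0).

Definition plant_solution (R : realType) (n nu : nat) (A W : 'M[R]_n)
    (B : 'M[R]_(n, nu)) (f : 'cV[R]_n -> 'cV[R]_n)
    (u : R -> 'cV[R]_nu) (x : R -> 'cV[R]_n) : Prop :=
  primitive x (fun t => A *m x t + W *m f (x t) + B *m u t).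

Definition sqrt_sgn (R : realType) (s : R) : R := Num.sqrt `|s| * Num.sg s.

Definition Sign (R : realType) (s : R) : set R :=
  if s == 0 then [set` `[-1, 1]] else [set Num.sg s].

(* The inclusion for [z2] is expressed by an integrable selection [s] of the
   set-valued sign; the selection is measurable because [primitive] requires
   its multiple to be integrable and [k2], [L j] are positive where used. *)
Definition homogeneous_observer (R : realType) (n nu ny : nat)
    (B : 'M[R]_(n, nu)) (C : 'M[R]_(ny, n)) (k1 k2 : R) (L : 'I_ny -> R)
    (u : R -> 'cV[R]_nu) (y z1 z2 : R -> 'cV[R]_ny) : Prop :=
  primitive z1 (fun t => \col_j
    (z2 t j ord0 + (C *m B *m u t) j ord0 +
     L j * k1 * sqrt_sgn (y t j ord0 - z1 t j ord0))) /\
  exists s : R -> 'cV[R]_ny,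
    {ae (@lebesgue_measure R), forall t, 0 <= t ->
      forall j, Sign (y t j ord0 - z1 t j ord0) (s t j ord0)} /\
    primitive z2 (fun t => \col_j (L j ^+ 2 * k2 * s t j ord0)).

Definition state_observer (R : realType) (n nu ny : nat) (A W : 'M[R]_n)
    (B : 'M[R]_(n, nu)) (C : 'M[R]_(ny, n)) (f : 'cV[R]_n -> 'cV[R]_n)
    (K K' E : 'M[R]_(n, ny)) (u : R -> 'cV[R]_nu) (y z2 : R -> 'cV[R]_ny)
    (xh : R -> 'cV[R]_n) : Prop :=
  let zeta t := xh t + E *m (y t - C *m xh t) in
  primitive xh (fun t =>
    A *m xh t + W *m f (zeta t) + K *m (y t - C *m xh t)
    - K' *m (C *m A *m xh t + C *m W *m f (zeta t) - z2 t) + B *m u t).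

Definition LMI_matrix (R : realType) (n ny : nat) (A W : 'M[R]_n)
    (C : 'M[R]_(ny, n)) (gamma lambda : 'rV[R]_n) (P : 'M[R]_n) (q : R)
    (K K' E : 'M[R]_(n, ny)) : 'M[R]_(n + n) :=
  let AK' := (1%:M - K' *m C) *m A in
  let WK' := (1%:M - K' *m C) *m W in
  let M11 := He (P *m (AK' - K *m C)) + q%:M in
  let M12 := P *m WK' +
    (1%:M - E *m C)^T *m diag_mx gamma *m diag_mx lambda in
  let M22 := - (2 *: diag_mx lambda) in
  block_mx M11 M12 M12^T M22.

(* Main.v *)
Require Import Defs.
From HB Require Import structures.
From mathcomp Require Import all_boot all_order all_algebra.
From mathcomp Require Import all_classical all_reals all_analysis.
From mathcomp Require Import ring lra.

Set Implicit Arguments.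
Unset Strict Implicit.
Unset Printing Implicit Defensive.

Import Order.TTheory GRing.Theory Num.Theory.
Import numFieldNormedType.Exports.

Local Open Scope classical_set_scope.
Local Open Scope ring_scope.

(** Put phi = C A x + C W f(x), so that the output y = C x satisfies
    y' = phi + C B u.  The proof has two independent halves.

    Finite-time reconstruction.  For one output channel put a = y_j - z1_j and
    b = phi_j - z2_j.  The input cancels and
      a' = b - L k1 sqrt_sgn a,    b' = phi_j' - L^2 k2 sign a.
    The trajectory x lives in a compact set and u is essentially bounded, so x
    is Lipschitz in time; f being Lipschitz, so is phi, with a constant M that
    depends neither on the solution nor on L ([output_drift_lipschitz]).  With
    k1 = 4, k2 = 1 and L >= M + 1 the system is overdamped, and a Lyapunov
    function can be replaced by a picture of the phase plane.  The region
    a > 0, b < (L k1 / 2) sqrt a and its mirror image can be left but never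
    entered ([fast_side_backward]), and they are left in finite time since
    there sqrt |a| decreases at least at a fixed rate ([fast_side_leaves]).
    Outside both regions b has the sign of a, hence |b| decreases at a rate of
    at least L^2 k2 - M until it vanishes, and it stays null afterwards
    ([super_twisting_le0], [super_twisting_finite_time]).  Since b enters only
    through bounds on its increments, this needs no derivative of b: the
    almost-everywhere information on z2 and x is integrated once and for all
    ([primitive1_le], [primitive1_ge]), whereas a is continuously
    differentiable ([primitive1_derive]).

    Exponential decay.  After reconstruction, e = xh - x obeys
      e' = (A_K' - K C) e + W_K' (f(zeta) - f(x)),
      zeta - x = (I - E C) e.
    Evaluating the matrix inequality at (e, f(zeta) - f(x)) and adding the
    sector condition bounds the derivative of e^T P e by - q |e|^2
    ([lmi_dissipation]).  Comparing e^T P e with |e|^2 through the extreme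
    eigenvalues of P, which are the extreme values of the form on the unit
    sphere ([rayleigh]), gives the rate and the constant of the claim
    ([lyapunov_decay]). *)

(** * Real functions of one variable *)

Lemma continuous_pos_ball (R : realType) (g : R -> R) (t : R) :
  {for t, continuous g} -> 0 < g t ->
  exists2 d, 0 < d & forall r, `|t - r| < d -> 0 < g r.
Proof.
move=> cg gt0; have /cvgr_gt/(_ _ gt0) := cg.
by move=> /nbhs_ballP[d /= d0 dP]; exists d => // r rd; exact: (dP r).
Qed.

Lemma continuous_at_within (R : realType) (g : R -> R) (a b : R) :
  (forall t, a <= t <= b -> {for t, continuous g}) ->
  {within `[a, b], continuous g}.
Proof.
move=> cg; apply: continuous_in_subspaceT => t.
by rewrite inE /= in_itv /=; exact: cg.
Qed.

(** Continuous induction run backwards: positivity can only be lost at a last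
    zero s of g before t2, which the last hypothesis excludes.  This is how a
    region of the phase plane is shown to have no entry. *)
Lemma backward_positive (R : realType) (g : R -> R) (t1 t2 : R) :
  (forall t, t1 <= t <= t2 -> {for t, continuous g}) -> 0 < g t2 ->
  (forall s, t1 <= s < t2 -> (forall r, s < r <= t2 -> 0 < g r) ->
     g s = 0 -> False) ->
  forall s, t1 <= s <= t2 -> 0 < g s.
Proof.
move=> cg g2 step s0 /andP[s01 s02]; rewrite ltNge; apply/negP => gs0.
pose Z := [set s | t1 <= s <= t2 /\ g s <= 0].
have supZ : has_sup Z.
  by split; [exists s0; rewrite /Z /= s01 | exists t2 => r [/andP[]]].
have Zub : ubound Z (sup Z) by apply: sup_upper_bound.
have zs0 : s0 <= sup Z by apply: Zub; split; rewrite ?s01.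
have zt2 : sup Z <= t2 by apply: ge_sup; [case: supZ | move=> r [/andP[]]].
have zt : t1 <= sup Z <= t2 by rewrite zt2 (le_trans s01).
have after r : sup Z < r <= t2 -> 0 < g r.
  move=> /andP[zr rt2]; rewrite ltNge; apply/negP => gr.
  suff : r <= sup Z by rewrite leNgt zr.
  by apply: Zub; split; rewrite // rt2 (le_trans _ (ltW zr)) // (le_trans s01).
have gz0 : g (sup Z) <= 0.
  rewrite leNgt; apply/negP => gz.
  have [d d0 dP] := continuous_pos_ball (cg _ zt) gz.
  have [r /[dup] Zr [_ gr] rd] := sup_adherent d0 supZ.
  have : 0 < g r; last by rewrite ltNge gr.
  apply: dP; rewrite ger0_norm ?subr_ge0; last exact: Zub.
  by rewrite ltrBlDr addrC -ltrBlDr.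
have zlt : sup Z < t2.
  by rewrite lt_neqAle zt2 andbT; apply: contraTneq g2 => <-; rewrite -leNgt.
have gz : g (sup Z) = 0.
  apply/eqP; rewrite eq_le gz0 /= leNgt; apply/negP => gzn.
  have cN : {for sup Z, continuous (- g)} by apply: continuousN; exact: cg.
  have gNn : 0 < (- g) (sup Z) by rewrite oppr_gt0.
  have [d d0 dP] := continuous_pos_ball cN gNn.
  pose r := sup Z + Num.min (d / 2) (t2 - sup Z).
  have m0 : 0 < Num.min (d / 2) (t2 - sup Z).
    by rewrite lt_min divr_gt0 // subr_gt0.
  have : 0 < g r.
    by apply: after; rewrite ltrDl m0 -lerBrDl ge_min lexx orbT.
  have : 0 < (- g) r.
    apply: dP; rewrite opprD addNKr normrN gtr0_norm // gt_min.
    by rewrite ltr_pdivrMr // mulr_natr mulr2n ltrDl d0.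
  by rewrite oppr_gt0 => /lt_trans h /h; rewrite ltxx.
apply: (step (sup Z)) => //.
by rewrite zlt andbT; case/andP: zt.
Qed.

Lemma MVT_le (R : realType) (g dg : R -> R) (m s t : R) : s < t ->
  (forall r, s < r < t -> is_derive r 1 g (dg r)) ->
  (forall r, s <= r <= t -> {for r, continuous g}) ->
  (forall r, s < r < t -> dg r <= m) -> g t - g s <= m * (t - s).
Proof.
move=> st gd gc gm.
have gd' r : r \in `]s, t[ -> is_derive r 1 g (dg r).
  by rewrite in_itv; exact: gd.
have [c] := MVT st gd' (continuous_at_within gc).
by rewrite in_itv => /gm cm ->; rewrite ler_wpM2r // subr_ge0 ltW.
Qed.

(** * Finite-time convergence of the super-twisting system *)

Lemma sqrt_sgn_gt0 (R : realType) (s : R) : 0 < s -> sqrt_sgn s = Num.sqrt s.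
Proof. by move=> s0; rewrite /sqrt_sgn gtr0_norm // gtr0_sg // mulr1. Qed.

Lemma sqrt_sgnN (R : realType) (s : R) : sqrt_sgn (- s) = - sqrt_sgn s.
Proof. by rewrite /sqrt_sgn normrN sgrN mulrN. Qed.

Lemma sqrt_sgn0 (R : realType) : sqrt_sgn (0 : R) = 0.
Proof. by rewrite /sqrt_sgn sgr0 mulr0. Qed.

(** The planar system a' = b - k sqrt_sgn a, b' in [-d, d] - m sign a with
    D = m + d and eta = m - d.  The inclusion for b is stated by its integrated
    consequences on intervals where a keeps its sign, which hold for absolutely
    continuous b without speaking of its derivative. *)
Record super_twisting (R : realType) (k D eta : R) (a b : R -> R) : Prop :=
  SuperTwisting {
    twist_deriv : forall t : R, 0 < t ->
      is_derive t 1 a (b t - k * sqrt_sgn (a t));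
    twist_lip : forall s t : R, 0 < s -> s <= t -> `|b t - b s| <= D * (t - s);
    twist_pos : forall s t : R, 0 < s -> s <= t ->
      (forall r, s <= r <= t -> 0 < a r) -> b t - b s <= - (eta * (t - s));
    twist_neg : forall s t : R, 0 < s -> s <= t ->
      (forall r, s <= r <= t -> a r < 0) -> eta * (t - s) <= b t - b s }.

Lemma super_twistingN (R : realType) (k D eta : R) (a b : R -> R) :
  super_twisting k D eta a b ->
  super_twisting k D eta (fun t => - a t) (fun t => - b t).
Proof.
case=> ad lip pos neg; split.
- move=> t t0; have adt := ad t t0.
  rewrite sqrt_sgnN mulrN -opprD.
  exact: (@is_deriveN _ _ _ a).
- by move=> s t s0 st; rewrite -opprD normrN; exact: lip.
- move=> s t s0 st aN; have : eta * (t - s) <= b t - b s.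
    by apply: neg => // r /aN; rewrite oppr_gt0.
  lra.
- move=> s t s0 st aP; have : b t - b s <= - (eta * (t - s)).
    by apply: pos => // r /aP; rewrite oppr_lt0.
  lra.
Qed.

(** In the section below, [Dk] is the overdamping condition: it makes the curve
    b = (k / 2) sqrt a impassable from above. *)
Section SuperTwisting.
Variables (R : realType) (k D eta : R).
Hypotheses (k_gt0 : 0 < k) (eta_gt0 : 0 < eta) (Dk : D <= k ^+ 2 / 8).

(** On the right half plane a' vanishes along b = k sqrt a; here b lies below
    half of that value, so that a' < - (k / 2) sqrt a.  The mirror image of
    this region is obtained by negating both arguments. *)
Definition fast_side (a b : R -> R) (t : R) :=
  0 < a t /\ b t < k / 2 * Num.sqrt (a t).

Lemma twist_continuous_a a b t :
  super_twisting k D eta a b -> 0 < t -> {for t, continuous a}.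
Proof.
move=> tw t0; apply: differentiable_continuous; apply/derivable1_diffP.
by have [] := twist_deriv tw t0.
Qed.

Lemma increment_bound_continuous (b : R -> R) t :
  (forall s t, 0 < s -> s <= t -> `|b t - b s| <= D * (t - s)) -> 0 < t ->
  {for t, continuous b}.
Proof.
move=> lip t0; apply/cvgrPdist_lt => e e0.
have D0 : 0 <= D.
  by have := le_trans (normr_ge0 _) (lip t (t + 1) t0 ltac:(lra)); nra.
near=> r.
have r0 : 0 < r by near: r; exact: lt_nbhsr.
apply: (@le_lt_trans _ _ (D * `|t - r|)).
  have [tr|/ltW rt] := leP t r.
    by rewrite distrC [`|t - r|]distrC [`|r - t|]ger0_norm ?subr_ge0 // lip.
  by rewrite [`|t - r|]ger0_norm ?subr_ge0 // lip.
have : `|t - r| < e / (D + 1).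
  by near: r; apply: cvgr_dist_lt; [exact: cvg_id | rewrite divr_gt0 //; lra].
rewrite ltr_pdivlMr; last lra.
have := normr_ge0 (t - r); nra.
Unshelve. all: by end_near. Qed.

Lemma twist_continuous_b a b t :
  super_twisting k D eta a b -> 0 < t -> {for t, continuous b}.
Proof.
by move=> tw; apply: increment_bound_continuous; exact: twist_lip tw.
Qed.

Lemma twist_continuous_sqrt a b t :
  super_twisting k D eta a b -> 0 < t ->
  {for t, continuous (fun r => Num.sqrt (a r))}.
Proof.
move=> tw t0; apply: (@continuous_comp _ _ _ a Num.sqrt).
  exact: twist_continuous_a tw t0.
exact: sqrt_continuous.
Qed.

(** (sqrt a)' = a' / (2 sqrt a) < - k / 4 because a' < - (k / 2) sqrt a. *)
Lemma fast_side_sqrt a b s t : super_twisting k D eta a b -> 0 < s -> s < t ->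
  (forall r, s < r < t -> fast_side a b r) ->
  Num.sqrt (a t) - Num.sqrt (a s) <= - (k / 4) * (t - s).
Proof.
move=> tw s0 st fast.
apply: (@MVT_le R (Num.sqrt \o a)
  (fun r => (2 * Num.sqrt (a r))^-1 * (b r - k * sqrt_sgn (a r)))) => //.
- move=> r srt; have [ar _] := fast r srt.
  apply: is_derive1_comp; first exact: is_derive1_sqrt.
  by apply: twist_deriv tw _ _; case/andP: srt => /(lt_trans s0).
- move=> r /andP[sr _]; apply: twist_continuous_sqrt tw _.
  exact: lt_le_trans s0 sr.
- move=> r srt; have [ar br] := fast r srt.
  rewrite sqrt_sgn_gt0 // mulrC ler_pdivrMr ?mulr_gt0 ?sqrtr_gt0 //; nra.
Qed.

(** Nothing enters the fast region.  An entry could only happen across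
    b = (k / 2) sqrt a, since sqrt a decreases inside; but there
    (k / 2) sqrt a falls at least at the rate k ^ 2 / 8, and b falls at most
    at the rate D <= k ^ 2 / 8. *)
Lemma fast_side_backward a b t1 t2 : super_twisting k D eta a b ->
  0 < t1 -> t1 <= t2 -> fast_side a b t2 -> fast_side a b t1.
Proof.
move=> tw t10 t12 [a2 b2].
pose g := (a \min (fun t => k / 2 * Num.sqrt (a t) - b t)).
have gE t : 0 < g t <-> fast_side a b t.
  by rewrite /g /fast_side /= lt_min subr_gt0; split => /andP.
suff /gE : 0 < g t1 by [].
apply: (@backward_positive R g t1 t2); last by rewrite lexx.
- move=> t /andP[t1t _]; have t0 := lt_le_trans t10 t1t.
  apply: continuous_min; first exact: twist_continuous_a tw t0.
  apply: (@continuousB _ _ _ (fun t => k / 2 * Num.sqrt (a t)) b).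
    apply: (@continuousM _ _ (fun=> k / 2) (fun t => Num.sqrt (a t))).
      exact: cst_continuous.
    exact: twist_continuous_sqrt tw t0.
  exact: twist_continuous_b tw t0.
- exact/gE.
move=> s /andP[t1s st2] after gs.
have s0 := lt_le_trans t10 t1s.
have sqd : Num.sqrt (a t2) - Num.sqrt (a s) <= - (k / 4) * (t2 - s).
  apply: fast_side_sqrt tw s0 st2 _ => r /andP[sr rt2].
  by apply/gE/after; rewrite sr ltW.
have kst : 0 < k * (t2 - s) by rewrite mulr_gt0 // subr_gt0.
have sa : 0 < Num.sqrt (a s) by have := sqrtr_ge0 (a t2); lra.
have as0 : 0 < a s by rewrite -sqrtr_gt0.
have bs : k / 2 * Num.sqrt (a s) <= b s.
  by move: gs; rewrite /g /= minEle; case: ifP => _; lra.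
have := twist_lip tw s0 (ltW st2).
rewrite ler_norml => /andP[bl _].
have : D * (t2 - s) <= k ^+ 2 / 8 * (t2 - s).
  by rewrite ler_wpM2r // subr_ge0 ltW.
have : k / 2 * (Num.sqrt (a t2) - Num.sqrt (a s)) <=
       k / 2 * (- (k / 4) * (t2 - s)) by rewrite ler_wpM2l // divr_ge0 // ltW.
move: b2 bs; rewrite expr2; lra.
Qed.

(** Outside the two fast regions b has the sign of a, whenever a is not 0, and
    |b| >= (k / 2) sqrt |a|. *)
Definition slow_zone (a b : R -> R) (t : R) :=
  ~ fast_side a b t /\ ~ fast_side (fun t => - a t) (fun t => - b t) t.

Lemma slow_zone_forward a b t1 t2 : super_twisting k D eta a b ->
  0 < t1 -> t1 <= t2 -> slow_zone a b t1 -> slow_zone a b t2.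
Proof.
move=> tw t10 t12 [s1 s2]; split => f.
  exact/s1/(fast_side_backward tw t10 t12).
exact/s2/(fast_side_backward (super_twistingN tw) t10 t12).
Qed.

(** A trajectory that stays in the fast region would make sqrt a negative. *)
Lemma fast_side_leaves a b t1 : super_twisting k D eta a b -> 0 < t1 ->
  exists2 t, t1 <= t & ~ fast_side a b t.
Proof.
move=> tw t10; apply: contrapT => /forall2NP none.
(* sqrt a loses k / 4 per unit of time: at t2 it would be at most - k / 4 *)
pose t2 := t1 + (4 / k * Num.sqrt (a t1) + 1).
have k4 : 0 < 4 / k by rewrite divr_gt0.
have t12 : t1 < t2.
  by rewrite ltrDl ltr_wpDl // mulr_ge0 ?sqrtr_ge0 // ltW.
have := fast_side_sqrt tw t10 t12.
have -> : - (k / 4) * (t2 - t1) = - Num.sqrt (a t1) - k / 4.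
  by rewrite /t2; field; rewrite gt_eqF.
move=> h.
suff : Num.sqrt (a t2) - Num.sqrt (a t1) <= - Num.sqrt (a t1) - k / 4.
  have k40 : 0 < k / 4 by rewrite divr_gt0.
  by have := sqrtr_ge0 (a t2); lra.
apply: h => r /andP[rt1 _].
by have [|/contrapT] := none r; first by rewrite ltW.
Qed.

(** The region that was left first cannot be entered again while the mirror
    region is being left. *)
Lemma slow_zone_reached a b : super_twisting k D eta a b ->
  exists2 t, 1 <= t & slow_zone a b t.
Proof.
move=> tw; have twN := super_twistingN tw.
have [t1 t11 n1] := fast_side_leaves tw (@ltr01 R).
have t10 : 0 < t1 by exact: lt_le_trans t11.
have [t2 t12 n2] := fast_side_leaves twN t10.
exists t2; first exact: le_trans t12.
split => // f; apply: n1; exact: fast_side_backward f.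
Qed.

(** The slow zone only gives 0 <= a where 0 < b.  If a vanished at t it would
    have a local minimum there, although a' = b > 0. *)
Lemma slow_zone_pos a b t0 t : super_twisting k D eta a b -> 0 < t0 ->
  (forall t, t0 <= t -> slow_zone a b t) -> t0 < t -> 0 < b t -> 0 < a t.
Proof.
move=> tw t00 slow t0t bt.
have tp := lt_trans t00 t0t.
have a_ge0 r : t0 <= r -> 0 < b r -> 0 <= a r.
  move=> t0r br; rewrite leNgt; apply/negP => ar.
  have [_] := slow r t0r; apply; split; rewrite ?oppr_gt0 //.
  apply: (@lt_le_trans _ _ 0); rewrite ?oppr_lt0 // mulr_ge0 ?sqrtr_ge0 //.
  by rewrite divr_ge0 // ltW.
rewrite lt_neqAle a_ge0 ?ltW // andbT eq_sym; apply/eqP => at0.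
have [d d0 dP] := continuous_pos_ball (twist_continuous_b tw tp) bt.
pose e := Num.min d (t - t0).
have e0 : 0 < e by rewrite lt_min d0 subr_gt0.
have : is_derive t 1 a 0.
  apply: (@derive1_at_min R a (t - e) (t + e)); first lra.
  - move=> r; rewrite in_itv /= => /andP[er _].
    have rp : 0 < r.
      apply: lt_trans er; apply: lt_le_trans t00 _.
      by rewrite lerBrDr -lerBrDl ge_min lexx orbT.
    by have [] := twist_deriv tw rp.
  - by rewrite in_itv /=; lra.
  - move=> r; rewrite in_itv /= at0 => /andP[er re]; apply: a_ge0.
      have : e <= t - t0 by rewrite ge_min lexx orbT.
      by move: er; lra.
    apply: dP; apply: (@lt_le_trans _ _ e); last by rewrite ge_min lexx.
    by rewrite ltr_norml; lra.
move=> /@derive_val; have := twist_deriv tw tp => /@derive_val ->.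
by rewrite at0 sqrt_sgn0; lra.
Qed.

(** As long as b > 0 also a > 0, so b decreases at the rate eta; and b is
    positive on the whole of ]t0, t], because going back in time from t to a
    last zero of b it never gets below b t. *)
Lemma slow_zone_decrease a b t0 t : super_twisting k D eta a b -> 0 < t0 ->
  (forall t, t0 <= t -> slow_zone a b t) -> t0 <= t -> 0 < b t ->
  forall s, t0 < s -> s <= t -> b t + eta * (t - s) <= b s.
Proof.
move=> tw t00 slow t0t bt s0 t0s0 s0t.
have decr s : t0 < s -> s <= t -> (forall r, s <= r <= t -> 0 < b r) ->
    b t + eta * (t - s) <= b s.
  move=> t0s st bp.
  have := twist_pos tw (lt_trans t00 t0s) st.
  have /[swap] /[apply] : forall r, s <= r <= t -> 0 < a r.
    move=> r /[dup] /andP[sr _] /bp br.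
    by apply: (slow_zone_pos tw t00 slow _ br); exact: lt_le_trans sr.
  lra.
apply: (decr s0) => // r /andP[s0r rt].
apply: (@backward_positive R b s0 t); last by rewrite s0r.
- move=> r' /andP[s0r' _]; apply: twist_continuous_b tw _.
  by rewrite (lt_trans t00) // (lt_le_trans t0s0).
- exact: bt.
move=> s /andP[s0s st] after bs0.
have t0s := lt_le_trans t0s0 s0s.
have bbig r' : s < r' <= t -> b t <= b r'.
  move=> /andP[sr' r't].
  have /= := decr r' (lt_trans t0s sr') r't.
  have /[swap] /[apply] : forall r, r' <= r <= t -> 0 < b r.
    by move=> r'' /andP[r'r'' r''t]; apply: after; rewrite (lt_le_trans sr').
  have : 0 <= eta * (t - r') by rewrite mulr_ge0 ?subr_ge0 // ltW.
  lra.
have sp := lt_trans t00 t0s.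
suff : b t <= 0 by rewrite leNgt bt.
apply/ler_addgt0Pr => e e0; rewrite add0r.
have D0 : 0 <= D.
  have := le_trans (normr_ge0 _) (twist_lip tw sp (ltW st)).
  by rewrite pmulr_lge0 // subr_gt0.
pose r' := s + Num.min (t - s) (e / (D + 1)).
have m0 : 0 < Num.min (t - s) (e / (D + 1)).
  by rewrite lt_min subr_gt0 st divr_gt0 //; lra.
have sr' : s < r' by rewrite ltrDl.
have r't : r' <= t by rewrite -lerBrDl ge_min lexx.
apply: le_trans (bbig r' _) _; first by rewrite sr'.
have := le_trans (ler_norm _) (twist_lip tw sp (ltW sr')).
rewrite bs0 subr0 => /le_trans; apply.
rewrite /r' addrC addKr.
apply: (@le_trans _ _ ((D + 1) * (e / (D + 1)))); last first.
  by rewrite mulrC divfK // gt_eqF //; lra.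
by apply: ler_pM; rewrite ?(ltW m0) ?ge_min ?lexx ?orbT //; lra.
Qed.

(** A positive value of b at time t forces b to have been larger than
    eta (t - s) at a fixed time s, which bounds t. *)
Lemma super_twisting_le0 a b : super_twisting k D eta a b ->
  exists2 T, 0 < T & forall t, T <= t -> b t <= 0.
Proof.
move=> tw; have [t0 t01 slow0] := slow_zone_reached tw.
have t00 : 0 < t0 by exact: lt_le_trans t01.
have slow t : t0 <= t -> slow_zone a b t.
  by move=> t0t; exact: slow_zone_forward tw t00 t0t slow0.
pose s := t0 + 1.
exists (s + `|b s| / eta).
  by rewrite ltr_pwDl ?divr_ge0 // ?(ltW eta_gt0) // /s; lra.
move=> t Tt; rewrite leNgt; apply/negP => bt.
have st : s <= t by apply: le_trans Tt; rewrite lerDl divr_ge0 // ltW.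
have t0s : t0 < s by rewrite ltrDl.
have := slow_zone_decrease tw t00 slow (le_trans (ltW t0s) st) bt t0s st.
have : `|b s| <= eta * (t - s) by rewrite mulrC -ler_pdivrMr // lerBrDl.
have := ler_norm (b s); lra.
Qed.

Lemma super_twisting_finite_time a b : super_twisting k D eta a b ->
  exists2 T, 0 < T & forall t, T <= t -> b t = 0.
Proof.
move=> tw; have [T1 T10 le1] := super_twisting_le0 tw.
have [T2 T20 le2] := super_twisting_le0 (super_twistingN tw).
exists (Num.max T1 T2); first by rewrite lt_max T10.
move=> t; rewrite ge_max => /andP[/le1 b1 /le2]; rewrite oppr_le0 => b2.
by apply/eqP; rewrite eq_le b1.
Qed.

End SuperTwisting.

(** * Indefinite integrals of integrable functions *)

Section Primitive1.
Variable R : realType.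
Notation mu := (@lebesgue_measure R).
Implicit Types x y v w : R -> R.

(** A single coordinate of [primitive]. *)
Definition primitive1 x v := forall t : R, 0 <= t ->
  mu.-integrable `[0, t] (EFin \o v) /\
  x t = x 0 + \int[mu]_(s in `[0, t]) v s.

Lemma eq_primitive1 x y v w : (forall t, 0 <= t -> x t = y t) ->
  (forall t, 0 <= t -> v t = w t) -> primitive1 x v -> primitive1 y w.
Proof.
move=> xy vw xv t t0; have [iv xt] := xv t t0.
have vwt : {in `[0, t]%classic, v =1 w}.
  by move=> s; rewrite inE /= in_itv /= => /andP[/vw].
split.
  by apply: eq_integrable iv => // s /vwt /= ->.
by rewrite -!xy // xt; congr (_ + _); exact: eq_Rintegral.
Qed.

Lemma primitive1_0 : primitive1 (fun=> 0) (fun=> 0).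
Proof.
move=> t t0; split; first exact: integrable0.
by rewrite /Rintegral integral0 addr0.
Qed.

Lemma primitive1_lin c x y v w : primitive1 x v -> primitive1 y w ->
  primitive1 (fun t => c * x t + y t) (fun t => c * v t + w t).
Proof.
move=> xv yw t t0; have [iv xt] := xv t t0; have [iw yt] := yw t t0.
have icv : mu.-integrable `[0, t] (EFin \o (fun s => c * v s)).
  exact: (@integrableZl _ _ _ mu _ _ c (EFin \o v)).
split; first exact: (@integrableD _ _ _ mu _ _ (EFin \o (fun s => c * v s))
  (EFin \o w)).
by rewrite RintegralD // RintegralZl // xt yt; lra.
Qed.

Lemma primitive1N x v : primitive1 x v ->
  primitive1 (fun t => - x t) (fun t => - v t).
Proof.
move=> /(primitive1_lin (-1))/(_ primitive1_0).
by apply: eq_primitive1 => t _; rewrite mulN1r addr0.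
Qed.

Lemma primitive1B x y v w : primitive1 x v -> primitive1 y w ->
  primitive1 (fun t => x t - y t) (fun t => v t - w t).
Proof.
move=> xv /(primitive1_lin (-1))/(_ xv).
by apply: eq_primitive1 => t _; rewrite mulN1r addrC.
Qed.

Lemma primitive1_sum n (c : 'I_n -> R) (X V : 'I_n -> R -> R) :
  (forall i, primitive1 (X i) (V i)) ->
  primitive1 (fun t => \sum_i c i * X i t) (fun t => \sum_i c i * V i t).
Proof.
move=> XV; elim: (index_enum _) => [|i r IH].
  by apply: eq_primitive1 primitive1_0 => t _; rewrite big_nil.
apply: eq_primitive1 (primitive1_lin (c i) (XV i) IH) => t _;
  by rewrite big_cons.
Qed.

Lemma primitive1_incr x v (s t : R) : primitive1 x v -> 0 <= s -> s <= t ->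
  mu.-integrable `[s, t] (EFin \o v) /\
  x t - x s = \int[mu]_(r in `[s, t]) v r.
Proof.
move=> xv s0 st; have [iv ->] := xv t (le_trans s0 st).
have [_ ->] := xv s s0; split.
  by apply: integrableS iv => //; apply: subset_itvr; rewrite bnd_simp.
rewrite opprD addrACA subrr add0r Rintegral_itvB ?bnd_simp //.
rewrite Rintegral_itv_obnd_cbnd //.
by apply: integrableS iv => //; apply: subset_itvr; rewrite bnd_simp.
Qed.

(** The integral of M - v is that of |M - v|, as the two agree almost
    everywhere. *)
Lemma primitive1_le x v (s t M : R) : primitive1 x v -> 0 <= s -> s <= t ->
  {ae mu, forall r, s <= r <= t -> v r <= M} -> x t - x s <= M * (t - s).
Proof.
move=> xv s0 st vM; have [iv ->] := primitive1_incr xv s0 st.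
have mI : measurable (`[s, t]%classic : set R) by [].
have iM : mu.-integrable `[s, t] (EFin \o (fun=> M)).
  apply: continuous_compact_integrable; first exact: segment_compact.
  by apply: continuous_subspaceT => r; exact: cst_continuous.
have ME : \int[mu]_(r in `[s, t]) M = M * (t - s).
  rewrite Rintegral_cst //= lebesgue_measure_itv /= lte_fin.
  by move: st; rewrite le_eqVlt => /predU1P[->|->]; rewrite ?ltxx ?subrr.
rewrite -ME -subr_ge0 -RintegralB //.
have iB : mu.-integrable `[s, t] (EFin \o (fun r => M - v r)).
  exact: (@integrableB _ _ _ mu _ _ (EFin \o (fun=> M)) (EFin \o v)).
rewrite /Rintegral (_ : (\int[mu]_(r in `[s, t]) (M - v r)%:E =
   \int[mu]_(r in `[s, t]) `|M - v r|%:E)%E).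
  by apply: fine_ge0; apply: integral_ge0 => r _; rewrite lee_fin.
apply: ae_eq_integral => //.
- by case/integrableP : iB.
- by case/integrableP : (integrable_norm iB).
- apply: (@filterS _ _ (ae_filter_ringOfSetsType mu)) vM => r vM.
  rewrite /= in_itv /= => /vM vr.
  by rewrite ger0_norm // subr_ge0.
Qed.

Lemma primitive1_ge x v (s t M : R) : primitive1 x v -> 0 <= s -> s <= t ->
  {ae mu, forall r, s <= r <= t -> M <= v r} -> M * (t - s) <= x t - x s.
Proof.
move=> xv s0 st vM.
have := primitive1_le (M := - M) (primitive1N xv) s0 st.
have /[swap] /[apply] : {ae mu, forall r, s <= r <= t -> - v r <= - M}.
  apply: (@filterS _ _ (ae_filter_ringOfSetsType mu)) vM => r vM /vM.
  by rewrite lerN2.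
lra.
Qed.

Lemma primitive1_continuous x v (t : R) : primitive1 x v -> 0 < t ->
  {for t, continuous x}.
Proof.
move=> xv t0.
have t10 : 0 < t + 1 by lra.
have [iv _] := xv (t + 1) (ltW t10).
have cP := parameterized_integral_continuous (ltW t10) iv.
have cPt : {for t, continuous (fun r => parameterized_integral mu 0 r v)}.
  apply: (within_continuous_continuous t10 cP).
  by rewrite in_itv /= t0 ltrDl ltr01.
apply: (@cvg_trans _ ((fun r => x 0 + parameterized_integral mu 0 r v) @ t)).
  apply: near_eq_cvg; near=> r.
  have r0 : 0 <= r by rewrite ltW //; near: r; exact: lt_nbhsr.
  by rewrite (xv r r0).2.
rewrite (xv t (ltW t0)).2; apply: cvgD cPt; exact: cvg_cst.
Unshelve. all: by end_near. Qed.

Lemma primitive1_derive x v (t : R) : primitive1 x v -> 0 < t ->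
  {for t, continuous v} -> is_derive t 1 x (v t).
Proof.
move=> xv t0 cv.
have t1 : t < t + 1 by rewrite ltrDl.
have [iv _] := xv (t + 1) (ltW (lt_trans t0 t1)).
have [dF F'] := continuous_FTC1_closed t1 iv t0 cv.
apply: (@near_eq_is_derive R R R
  (fun r => x 0 + \int[mu]_(s in `[0, r]) v s) x t 1 (v t)).
  near=> r; have r0 : 0 <= r by rewrite ltW //; near: r; exact: lt_nbhsr.
  by rewrite (xv r r0).2.
rewrite -[v t]add0r; apply: is_deriveD; rewrite -F' derive1E.
exact: derivableP.
Unshelve. all: by end_near. Qed.

End Primitive1.
(** * Extreme eigenvalues of a symmetric matrix *)

Lemma continuous_at_sum (R : realType) (T : topologicalType) n
    (F : 'I_n -> T -> R) (t : T) :
  (forall i, {for t, continuous (F i)}) ->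
  {for t, continuous (fun x => \sum_i F i x)}.
Proof.
move=> cF; elim: (index_enum _) => [|i r IH].
  rewrite (_ : (fun x => _) = fun=> 0); first exact: cst_continuous.
  by apply/funext => x; rewrite big_nil.
rewrite (_ : (fun x => _) = fun x => F i x + \sum_(j <- r) F j x).
  exact: (@continuousD _ _ _ (F i) (fun x => \sum_(j <- r) F j x)).
by apply/funext => x; rewrite big_cons.
Qed.

Section Rayleigh.
Variables (R : realType) (n : nat).
Implicit Types (v w : 'rV[R]_n) (X Y : 'M[R]_n).

(** The quadratic form is taken on row vectors since eigenvectors of a matrix
    are rows; [qform 1%:M] is the square of the Euclidean norm. *)
Definition qform X v := (v *m X *m v^T) ord0 ord0.

Lemma qformE X v : qform X v = \sum_i (\sum_j v ord0 j * X j i) * v ord0 i.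
Proof.
by rewrite /qform mxE; apply: eq_bigr => i _; rewrite !mxE.
Qed.

Lemma qform1E v : qform 1%:M v = \sum_i v ord0 i ^+ 2.
Proof.
by rewrite /qform mulmx1 mxE; apply: eq_bigr => i _; rewrite mxE expr2.
Qed.

Lemma qform1_ge0 v : 0 <= qform 1%:M v.
Proof. by rewrite qform1E sumr_ge0 // => i _; rewrite sqr_ge0. Qed.

Lemma qform1_eq0 v : qform 1%:M v = 0 -> v = 0.
Proof.
rewrite qform1E => /eqP; rewrite psumr_eq0; last by move=> i _; rewrite sqr_ge0.
move=> /allP v0; apply/rowP => i; rewrite mxE; apply/eqP.
by have := v0 i (mem_index_enum i); rewrite /= sqrf_eq0.
Qed.

Lemma qform1_gt0 v : v != 0 -> 0 < qform 1%:M v.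
Proof.
move=> v0; rewrite lt_neqAle qform1_ge0 andbT eq_sym.
by apply: contraNneq v0 => /qform1_eq0 ->.
Qed.

Lemma qformZ X c v : qform X (c *: v) = c ^+ 2 * qform X v.
Proof.
rewrite /qform -!scalemxAl [(c *: v)^T]linearZ /= -scalemxAr.
by rewrite !mxE mulrA expr2.
Qed.

Lemma qformN X v : qform (- X) v = - qform X v.
Proof. by rewrite /qform mulmxN mulNmx mxE. Qed.

Lemma qform_continuous X : continuous (qform X).
Proof.
rewrite (_ : qform X = fun v => \sum_i (\sum_j v ord0 j * X j i) * v ord0 i).
  move=> v; apply: continuous_at_sum => i.
  apply: (@continuousM _ _ (fun v => \sum_j v ord0 j * X j i)
    (fun v => v ord0 i)).
    apply: continuous_at_sum => j.
    apply: (@continuousM _ _ (fun v => v ord0 j) (fun=> X j i)).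
      exact: coord_continuous.
    exact: cst_continuous.
  exact: coord_continuous.
by apply/funext => v; rewrite qformE.
Qed.

Lemma sphere_compact : compact [set v | qform 1%:M v = 1].
Proof.
apply: bounded_closed_compact.
  exists 1; split => // M M1 v /= v1; rewrite [leLHS]mx_normrE.
  apply/bigmax_leP; split => [|[i j] _ /=].
    by rewrite ltW // (lt_trans _ M1).
  rewrite (le_trans _ (ltW M1)) // -(@ler_sqr _ _ 1) ?nnegrE // expr1n.
  rewrite real_normK ?num_real // -v1 qform1E (ord1 i) (bigD1 j) //= lerDl.
  by rewrite sumr_ge0 // => k _; rewrite sqr_ge0.
apply: (@closed_comp _ _ (qform 1%:M) [set 1]); last exact: closed_eq.
by move=> v _; exact: qform_continuous.
Qed.

(** For w = v Y the form at v + t w is 2 t |w|^2 + t^2 c with c the form at w;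
    it would be negative for small negative t if w were not 0. *)
Lemma psd_qform_kernel Y v : Y^T = Y -> (forall w, 0 <= qform Y w) ->
  qform Y v = 0 -> v *m Y = 0.
Proof.
move=> Ysym Yge0 Yv; set w := v *m Y; apply: qform1_eq0.
have expand t :
    qform Y (v + t *: w) = 2 * t * qform 1%:M w + t ^+ 2 * qform Y w.
  have wYv : (w *m Y *m v^T) ord0 ord0 = qform 1%:M w.
    by rewrite /qform mulmx1 {3}/w trmx_mul Ysym mulmxA.
  have vYw : (v *m Y *m w^T) ord0 ord0 = qform 1%:M w by rewrite /qform mulmx1.
  rewrite {1}/qform [(v + _)^T]linearD /= [(t *: w)^T]linearZ /=.
  rewrite !mulmxDl !mulmxDr.
  rewrite -!scalemxAl -!scalemxAr.
  rewrite mxE [X in X + _]mxE [X in _ + X]mxE.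
  rewrite [X in _ + X + _]mxE [X in _ + (X + _)]mxE [X in _ + (_ + X)]mxE.
  rewrite [(_ *: (w *m _ *m _)) _ _]mxE wYv vYw -!/(qform _ _) Yv; ring.
set b := qform 1%:M w; set c := qform Y w.
have c0 : 0 <= c by exact: Yge0.
have b0 : 0 <= b by exact: qform1_ge0.
have c1 : 0 < c + 1 by lra.
(* t = - b / (c + 1) makes the expression - (b / (c + 1))^2 (c + 2) *)
have := Yge0 (v + (- b / (c + 1)) *: w); rewrite expand -/b -/c.
have -> : 2 * (- b / (c + 1)) * b + (- b / (c + 1)) ^+ 2 * c =
  - (b / (c + 1)) ^+ 2 * (c + 2) by field; rewrite gt_eqF.
rewrite mulNr oppr_ge0 => le0; apply/eqP; rewrite -sqrf_eq0.
have : (b / (c + 1)) ^+ 2 = 0 by have := sqr_ge0 (b / (c + 1)); nra.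
move/eqP; rewrite !expf_eq0 /= mulf_eq0 invr_eq0 [c + 1 == 0]gt_eqF // orbF.
by [].
Qed.

(** The form attains its maximum m on the unit sphere, which is compact, at
    some v0.  Then m 1 - X is positive semidefinite and its form vanishes at
    v0, so v0 is in its kernel. *)
Lemma rayleigh X : (0 < n)%N -> X^T = X ->
  exists2 m, eigenvalue X m & forall v, qform X v <= m * qform 1%:M v.
Proof.
move=> n0 Xsym; pose S := [set v | qform 1%:M v = 1].
have S0 : S !=set0.
  exists (delta_mx ord0 (Ordinal n0)); rewrite /S /= qform1E.
  rewrite (bigD1 (Ordinal n0)) //= big1 ?mxE ?eqxx ?expr1n ?addr0 //.
  by move=> i /negbTE ni; rewrite mxE ni andbF expr0n.
have cX : {within S, continuous (qform X)}.
  exact/continuous_subspaceT/qform_continuous.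
have [v0 + max0] := EVT_max_rV S0 sphere_compact cX.
rewrite inE /S /= => v01.
have le v : qform X v <= qform X v0 * qform 1%:M v.
  have [->|vn0] := eqVneq v 0.
    by rewrite -(scale0r v0) !qformZ expr0n /= !mul0r mulr0.
  have v1 := qform1_gt0 vn0.
  set c := (Num.sqrt (qform 1%:M v))^-1.
  have c2 : c ^+ 2 = (qform 1%:M v)^-1 by rewrite exprVn sqr_sqrtr // ltW.
  have : qform X (c *: v) <= qform X v0.
    by apply: max0; rewrite inE /S /= qformZ c2 mulVf // gt_eqF.
  by rewrite qformZ c2 mulrC ler_pdivrMr.
exists (qform X v0) => //; apply/eigenvalueP; exists v0; last first.
  apply/eqP => v00; move: v01; rewrite v00 -(scale0r 0) qformZ expr0n mul0r.
  by move=> /eqP; rewrite eq_sym oner_eq0.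
set m := qform X v0.
have fY w : qform (m *: 1%:M - X) w = m * qform 1%:M w - qform X w.
  by rewrite /qform mulmxBr mulmxBl -scalemxAr -scalemxAl !mxE.
have : v0 *m (m *: 1%:M - X) = 0.
  apply: psd_qform_kernel.
  - by rewrite linearB /= linearZ /= trmx1 Xsym.
  - by move=> w; rewrite fY subr_ge0.
  - by rewrite fY v01 mulr1 subrr.
by rewrite mulmxBr -scalemxAr mulmx1 => /eqP; rewrite subr_eq0 => /eqP <-.
Qed.

Lemma eigenvalue_qform X a : eigenvalue X a ->
  exists2 v, v != 0 & qform X v = a * qform 1%:M v.
Proof.
move=> /eigenvalueP[v vX v0]; exists v => //.
by rewrite /qform vX mulmx1 -scalemxAl mxE.
Qed.

Lemma qform_le_lambda_max X v : (0 < n)%N -> X^T = X ->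
  eigenvalue X (lambda_max X) /\ qform X v <= lambda_max X * qform 1%:M v.
Proof.
move=> n0 Xsym; have [m Em mP] := rayleigh n0 Xsym.
suff -> : lambda_max X = m by [].
have ub : ubound [set a | eigenvalue X a] m.
  move=> a /= /eigenvalue_qform[w w0 wa].
  by have := mP w; rewrite wa ler_pM2r ?qform1_gt0.
apply/eqP; rewrite eq_le; apply/andP; split.
  by apply: ge_sup => //; exists m.
by apply: ub_le_sup => //; exists m.
Qed.

(** The spectrum of - X is the opposite of that of X. *)
Lemma lambda_min_le_qform X v : (0 < n)%N -> X^T = X ->
  eigenvalue X (lambda_min X) /\ lambda_min X * qform 1%:M v <= qform X v.
Proof.
move=> n0 Xsym.
have EN a : eigenvalue (- X) a = eigenvalue X (- a).
  by apply/eigenvalueP/eigenvalueP => -[w wX w0]; exists w => //;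
     rewrite ?mulmxN ?scaleNr -?wX ?mulmxN ?opprK // wX scaleNr opprK.
have -> : lambda_min X = - lambda_max (- X).
  rewrite /lambda_min /inf /lambda_max; congr (- sup _).
  apply/seteqP; split => a /=; rewrite EN.
    by move=> [b /= Eb <-]; rewrite opprK.
  by move=> Ea; exists (- a); rewrite ?opprK.
have [||E le] := @qform_le_lambda_max (- X) v; rewrite ?linearN /= ?Xsym //.
by rewrite -EN; split => //; move: le; rewrite qformN; lra.
Qed.

End Rayleigh.
(** * Exponential decay from a quadratic Lyapunov function *)

Lemma enormE (R : realType) n (v : 'cV[R]_n) :
  enorm v = Num.sqrt (qform 1%:M v^T).
Proof.
by rewrite /enorm qform1E; congr Num.sqrt; apply: eq_bigr => i _; rewrite mxE.
Qed.

Lemma mx11_trE (R : realType) (X : 'M[R]_1) : X^T ord0 ord0 = X ord0 ord0.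
Proof. by rewrite mxE. Qed.

Lemma is_derive_qform (R : realType) n (P : 'M[R]_n) (e : R -> 'cV[R]_n)
    (g : 'cV[R]_n) (t : R) : P^T = P ->
  (forall i, is_derive t 1 (fun s => e s i ord0) (g i ord0)) ->
  is_derive t 1 (fun s => qform P (e s)^T) (2 * ((e t)^T *m P *m g) ord0 ord0).
Proof.
move=> Psym eg.
have -> : (fun s => qform P (e s)^T) =
    \sum_i ((\sum_j (P j i \*: (fun s => e s j ord0))) * (fun s => e s i ord0)).
  apply/funext => s; rewrite qformE fct_sumE; apply: eq_bigr => i _.
  rewrite mxE /= fctE fct_sumE; congr (_ * _).
  by apply: eq_bigr => j _; rewrite mxE mulrC.
apply: (@is_derive_eq _ _ _ _ _ _ _ _ (is_derive_sum _)).
have gPe : (g^T *m P *m e t) ord0 ord0 = ((e t)^T *m P *m g) ord0 ord0.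
  by rewrite -mx11_trE !trmx_mul trmxK Psym mulmxA.
rewrite mulrDl mul1r -{1}gPe.
rewrite !mxE -big_split /=; apply: eq_bigr => i _.
rewrite fct_sumE /GRing.scale /= addrC ![(_ *m P) _ _]mxE.
congr (_ * _ + _); last (rewrite mulrC; congr (_ * _));
  by apply: eq_bigr => j _; rewrite mxE mulrC.
Qed.

(** V t * expR (c * (t - T0)) is nonincreasing. *)
Lemma differential_inequality (R : realType) (V dV : R -> R) (c T0 : R) :
  (forall t, T0 <= t -> is_derive t 1 V (dV t)) ->
  (forall t, T0 <= t -> dV t <= - c * V t) ->
  forall t, T0 <= t -> V t <= expR (- c * (t - T0)) * V T0.
Proof.
move=> Vd dVle t; rewrite le_eqVlt => /predU1P[<-|T0t].
  by rewrite subrr mulr0 expR0 mul1r.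
pose E s := expR (c * (s - T0)).
have Ed (s : R) : is_derive s 1 E (E s * c).
  apply: (@is_derive1_comp _ expR (fun s => c * (s - T0))).
  have d : is_derive s 1 (c \*: (id - cst T0)) (c *: (1 - 0)).
    by apply: is_deriveZ; apply: is_deriveB.
  by move: d; rewrite subr0 /GRing.scale /= mulr1.
have VEd s : T0 <= s -> is_derive s 1 (V * E) ((dV s + c * V s) * E s).
  move=> Ts; have := Vd s Ts => Vds.
  apply: (@is_derive_eq _ _ _ _ _ _ _ _ (is_deriveM _ _)).
  by rewrite /GRing.scale /=; ring.
have VEc r : T0 <= r <= t -> {for r, continuous (V * E)}.
  move=> /andP[/VEd[d _] _].
  exact/differentiable_continuous/derivable1_diffP.
have VEle r : T0 < r < t -> (dV r + c * V r) * E r <= 0.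
  move=> /andP[/ltW/dVle dr _]; apply: mulr_le0_ge0; last exact: expR_ge0.
  lra.
have VEd' r (h : T0 < r < t) := VEd r (ltW (andP h).1).
have := MVT_le T0t VEd' VEc VEle.
rewrite mul0r subr_le0 !fctE /E subrr mulr0 expR0 mulr1 => le.
rewrite mulNr expRN ler_pdivlMl ?expR_gt0 //.
by rewrite mulrC.
Qed.

Lemma pd_lambda_min_gt0 (R : realType) n (P : 'M[R]_n) : (0 < n)%N -> pd P ->
  0 < lambda_min P.
Proof.
move=> n0 [Psym Ppos].
have [/eigenvalue_qform[v v0 vE] _] := lambda_min_le_qform 0 n0 Psym.
have := Ppos v^T; rewrite trmxK -/(qform P v) vE.
rewrite pmulr_lgt0 ?qform1_gt0 //; apply.
by apply: contraNneq v0 => /(congr1 trmx); rewrite trmxK trmx0 => ->.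
Qed.

(** The dissipation q |e|^2 dominates (q / lambda_max P) e^T P e, so e^T P e
    decays at the rate q / lambda_max P; passing from e^T P e to |e|^2 costs
    lambda_max P / lambda_min P, and square roots halve the rate. *)
Lemma lyapunov_decay (R : realType) n (P : 'M[R]_n) (q T0 : R)
    (e g : R -> 'cV[R]_n) : (0 < n)%N -> pd P -> 0 < q ->
  (forall t, T0 <= t -> forall i,
     is_derive t 1 (fun s => e s i ord0) (g t i ord0)) ->
  (forall t, T0 <= t ->
     2 * ((e t)^T *m P *m g t) ord0 ord0 <= - q * qform 1%:M (e t)^T) ->
  forall t, T0 <= t ->
    enorm (e t) <= Num.sqrt (lambda_max P / lambda_min P) *
      expR (- (q / (2 * lambda_max P)) * (t - T0)) * enorm (e T0).
Proof.
move=> n0 Ppd q0 ed diss t T0t; have [Psym _] := Ppd.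
set M := lambda_max P; set m := lambda_min P.
have m0 : 0 < m by exact: pd_lambda_min_gt0.
have leM v : qform P v <= M * qform 1%:M v.
  by case: (qform_le_lambda_max v n0 Psym).
have lem v : m * qform 1%:M v <= qform P v.
  by case: (lambda_min_le_qform v n0 Psym).
have M0 : 0 < M.
  have [/eigenvalue_qform[v v0 _] _] := lambda_min_le_qform 0 n0 Psym.
  apply: (lt_le_trans m0); rewrite -(ler_pM2r (qform1_gt0 v0)).
  exact: le_trans (lem v) (leM v).
set rho := q / (2 * M).
have rhoE : q = 2 * rho * M by rewrite /rho; field; rewrite gt_eqF.
have rho0 : 0 < rho by rewrite divr_gt0 // mulr_gt0.
have Vle : qform P (e t)^T <= expR (- (2 * rho) * (t - T0)) * qform P (e T0)^T.
  apply: (@differential_inequality R (fun s => qform P (e s)^T)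
    (fun s => 2 * ((e s)^T *m P *m g s) ord0 ord0)) => // s T0s.
    by apply: is_derive_qform => //; exact: ed.
  apply: le_trans (diss s T0s) _.
  rewrite {1}rhoE !mulNr lerN2 -[_ * M * _]mulrA ler_pM2l ?leM // mulr_gt0 //.
set E := expR (- rho * (t - T0)).
have E2 : expR (- (2 * rho) * (t - T0)) = E ^+ 2.
  by rewrite /E -expRM_natl; congr expR; ring.
have N0 : 0 <= Num.sqrt (M / m) * E * enorm (e T0).
  by rewrite !mulr_ge0 ?sqrtr_ge0 ?expR_ge0.
suff : enorm (e t) ^+ 2 <= (Num.sqrt (M / m) * E * enorm (e T0)) ^+ 2.
  by rewrite ler_sqr ?nnegrE ?sqrtr_ge0.
rewrite !exprMn !enormE !sqr_sqrtr ?qform1_ge0 ?divr_ge0 ?(ltW M0) ?(ltW m0) //.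
rewrite -(ler_pM2l m0).
apply: le_trans (lem _) _; apply: le_trans Vle _; rewrite E2.
have -> : m * (M / m * E ^+ 2 * qform 1%:M (e T0)^T) =
          E ^+ 2 * (M * qform 1%:M (e T0)^T) by field; rewrite gt_eqF.
by rewrite ler_wpM2l ?sqr_ge0.
Qed.

(** The matrix inequality at the vector (e, d) reads
      2 e^T P e' + q |e|^2 + 2 (e^T F^T Gamma Lambda d - d^T Lambda d) <= 0
    with F = 1 - E C and e' the vector of the conclusion; the sector condition
    says that the last parenthesis is nonnegative. *)
Lemma lmi_dissipation (R : realType) n ny (A W : 'M[R]_n) (C : 'M[R]_(ny, n))
    (gamma lambda : 'rV[R]_n) (P : 'M[R]_n) (q : R) (K K' E : 'M[R]_(n, ny))
    (e d : 'cV[R]_n) :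
  nsd (LMI_matrix A W C gamma lambda P q K K' E) ->
  \sum_(i < n) lambda ord0 i * d i ord0 *
    (d i ord0 - gamma ord0 i * ((1%:M - E *m C) *m e) i ord0) <= 0 ->
  2 * (e^T *m P *m (((1%:M - K' *m C) *m A - K *m C) *m e
                   + (1%:M - K' *m C) *m W *m d)) ord0 ord0
  <= - q * qform 1%:M e^T.
Proof.
move=> [_ /(_ (col_mx e d))]; rewrite /LMI_matrix.
set X := (1%:M - K' *m C) *m A - K *m C; set Y := (1%:M - K' *m C) *m W.
set F := 1%:M - E *m C; set G := diag_mx gamma; set L := diag_mx lambda.
rewrite tr_col_mx mulmxN mulNmx mxE oppr_ge0.
rewrite mul_row_block mul_row_col => lmi sec.
have quadL : (d^T *m L *m d) ord0 ord0 =
    \sum_i lambda ord0 i * d i ord0 * d i ord0.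
  rewrite mxE; apply: eq_bigr => i _.
  by rewrite mul_mx_diag !mxE; ring.
have quadG : (e^T *m F^T *m G *m L *m d) ord0 ord0 =
    \sum_i lambda ord0 i * d i ord0 * (gamma ord0 i * (F *m e) i ord0).
  rewrite -trmx_mul mxE; apply: eq_bigr => i _.
  by rewrite !mul_mx_diag !mxE; ring.
have {}sec : (d^T *m L *m d) ord0 ord0 <= (e^T *m F^T *m G *m L *m d) ord0 ord0.
  rewrite quadL quadG -subr_le0 -sumrB; apply: le_trans sec.
  rewrite le_eqVlt; apply/orP; left; apply/eqP/eq_bigr => i _.
  by rewrite mulrBr.
set M12 := P *m Y + F^T *m G *m L in lmi.
have sym12 : (d^T *m M12^T *m e) ord0 ord0 = (e^T *m M12 *m d) ord0 ord0.
  by rewrite -mx11_trE !trmx_mul !trmxK mulmxA.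
have symX :
    (e^T *m (P *m X)^T *m e) ord0 ord0 = (e^T *m (P *m X) *m e) ord0 ord0.
  by rewrite -mx11_trE !trmx_mul !trmxK mulmxA.
have q1 : (e^T *m q%:M *m e) ord0 ord0 = q * qform 1%:M e^T.
  by rewrite mul_mx_scalar -scalemxAl mxE /qform mulmx1 trmxK.
have lhs : (e^T *m P *m (X *m e + Y *m d)) ord0 ord0 =
    (e^T *m (P *m X) *m e) ord0 ord0 + (e^T *m (P *m Y) *m d) ord0 ord0.
  by rewrite mulmxDr mxE !mulmxA.
have rhs : (e^T *m M12 *m d) ord0 ord0 = (e^T *m (P *m Y) *m d) ord0 ord0 +
    (e^T *m F^T *m G *m L *m d) ord0 ord0.
  by rewrite mulmxDr mulmxDl mxE !mulmxA.
clearbody M12 X Y F G L.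
have blocks : ((e^T *m (He (P *m X) + q%:M) + d^T *m M12^T) *m e +
    (e^T *m M12 + d^T *m - (2 *: L)) *m d) ord0 ord0 =
    2 * (e^T *m (P *m X) *m e) ord0 ord0 + q * qform 1%:M e^T +
    2 * (e^T *m M12 *m d) ord0 ord0 - 2 * (d^T *m L *m d) ord0 ord0.
  rewrite -q1 /He !(mulmxDl, mulmxDr) mulmxN -scalemxAr mulNmx -scalemxAl.
  have mxD (U V : 'M[R]_1) : (U + V) ord0 ord0 = U ord0 ord0 + V ord0 ord0.
    by rewrite mxE.
  have mxN (U : 'M[R]_1) : (- U) ord0 ord0 = - U ord0 ord0 by rewrite mxE.
  have mxZ a (U : 'M[R]_1) : (a *: U) ord0 ord0 = a * U ord0 ord0.
    by rewrite mxE.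
  rewrite !mxD mxN mxZ sym12 symX; ring.
by move: lmi; rewrite blocks lhs; lra.
Qed.
(** * Vector-valued curves *)

Lemma entry_le_norm (R : realType) m n (X : 'M[R]_(m, n)) i j :
  `|X i j| <= `|X|.
Proof.
rewrite [leRHS]mx_normrE.
exact: (le_bigmax _ (fun ij => `|X ij.1 ij.2|) (i, j)).
Qed.

Lemma norm_le_entries (R : realType) m n (X : 'M[R]_(m, n)) c : 0 <= c ->
  (forall i j, `|X i j| <= c) -> `|X| <= c.
Proof. by move=> c0 Xc; rewrite [leLHS]mx_normrE; apply/bigmax_leP; split. Qed.

(** A crude bound of the operator norm for the sup norm on vectors. *)
Definition entry_sum (R : realType) m n (X : 'M[R]_(m, n)) : R :=
  \sum_i \sum_j `|X i j|.

Lemma entry_sum_ge0 (R : realType) m n (X : 'M[R]_(m, n)) : 0 <= entry_sum X.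
Proof. by apply: sumr_ge0 => i _; apply: sumr_ge0. Qed.

Lemma mulmx_norm_le (R : realType) m n (X : 'M[R]_(m, n)) (v : 'cV[R]_n) :
  `|X *m v| <= entry_sum X * `|v|.
Proof.
apply: norm_le_entries => [|i j]; first by rewrite mulr_ge0 ?entry_sum_ge0.
rewrite mxE (le_trans (ler_norm_sum _ _ _)) // /entry_sum (bigD1 i) //= mulrDl.
rewrite -[leLHS]addr0 lerD //; last first.
  by rewrite mulr_ge0 // sumr_ge0 // => k _; rewrite sumr_ge0.
rewrite mulr_suml ler_sum // => k _; rewrite normrM ler_wpM2l //.
exact: entry_le_norm.
Qed.

Lemma lipschitz_bound (R : realType) n (f : 'cV[R]_n -> 'cV[R]_n) :
  [lipschitz f x | x in [set: 'cV[R]_n]] ->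
  exists2 k, 0 <= k & forall x y, `|f x - f y| <= k * `|x - y|.
Proof.
move=> /pinfty_ex_gt0[k k0 fk]; exists k; first exact: ltW.
by move=> x y; exact: (fk (x, y) (conj I I)).
Qed.

Lemma curve_continuous (R : realType) n (x : R -> 'cV[R]_n) (t : R) :
  (forall i, {for t, continuous (fun s => x s i ord0)}) ->
  {for t, continuous x}.
Proof.
move=> cx; apply/cvgrPdist_le => e e0.
have xi i : \forall s \near t, `|x t i ord0 - x s i ord0| <= e.
  by move/cvgrPdist_le : (cx i) => /(_ e e0).
have := @filter_forall R 'I_n _ (nbhs t) (nbhs_filter t) xi.
apply: filterS => s xe; apply: norm_le_entries; first exact: ltW.
by move=> i j; rewrite (ord1 j) !mxE.
Qed.

Lemma entry_continuous (R : realType) n (x : R -> 'cV[R]_n) (t : R) i :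
  {for t, continuous x} -> {for t, continuous (fun s => x s i ord0)}.
Proof.
move=> cx.
apply: (@continuous_comp _ _ _ x (fun v : 'cV[R]_n => v i ord0)) => //.
exact: coord_continuous.
Qed.

Lemma mulmx_curve_continuous (R : realType) m n (X : 'M[R]_(m, n))
    (x : R -> 'cV[R]_n) (t : R) :
  {for t, continuous x} -> {for t, continuous (fun s => X *m x s)}.
Proof.
move=> cx; apply: curve_continuous => i.
rewrite (_ : (fun s => _) = fun s => \sum_j X i j * x s j ord0); last first.
  by apply/funext => s; rewrite mxE.
apply: continuous_at_sum => j.
apply: (@continuousM _ _ (fun=> X i j) (fun s => x s j ord0)).
  exact: cst_continuous.
exact: entry_continuous.
Qed.

Arguments mulmx_curve_continuous {R m n} X {x t}.

Lemma curve_continuousD (R : realType) n (x y : R -> 'cV[R]_n) (t : R) :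
  {for t, continuous x} -> {for t, continuous y} ->
  {for t, continuous (fun s => x s + y s)}.
Proof. by move=> cx cy; exact: (@continuousD _ _ _ x y). Qed.

Lemma curve_continuousB (R : realType) n (x y : R -> 'cV[R]_n) (t : R) :
  {for t, continuous x} -> {for t, continuous y} ->
  {for t, continuous (fun s => x s - y s)}.
Proof. by move=> cx cy; exact: (@continuousB _ _ _ x y). Qed.

Lemma primitive1_entry (R : realType) n (x v : R -> 'cV[R]_n) i :
  primitive x v -> primitive1 (fun t => x t i ord0) (fun t => v t i ord0).
Proof. by move=> xv t t0; exact: xv. Qed.

Lemma primitive_curve_continuous (R : realType) n (x v : R -> 'cV[R]_n)
    (t : R) :
  primitive x v -> 0 < t -> {for t, continuous x}.
Proof.
move=> xv t0; apply: curve_continuous => i.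
exact: primitive1_continuous (primitive1_entry i xv) t0.
Qed.

Lemma primitive_mulmx (R : realType) m n (X : 'M[R]_(m, n))
    (x v : R -> 'cV[R]_n) :
  primitive x v -> primitive (fun t => X *m x t) (fun t => X *m v t).
Proof.
move=> xv i.
have := primitive1_sum (X i) (fun j => primitive1_entry j xv).
by apply: eq_primitive1 => t _; rewrite mxE.
Qed.

Lemma primitive_lipschitz (R : realType) n (x v : R -> 'cV[R]_n) (M : R) :
  0 <= M -> primitive x v ->
  {ae (@lebesgue_measure R), forall t, 0 <= t -> `|v t| <= M} ->
  forall s t, 0 <= s -> s <= t -> `|x t - x s| <= M * (t - s).
Proof.
move=> M0 xv vM s t s0 st.
apply: norm_le_entries => [|i j]; first by rewrite mulr_ge0 // subr_ge0.
rewrite (ord1 j) !mxE; have xvi := primitive1_entry i xv.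
have vi r : (0 <= r -> `|v r| <= M) -> s <= r <= t -> - M <= v r i ord0 <= M.
  move=> vr /andP[sr _]; rewrite -ler_norml.
  by apply: le_trans (vr (le_trans s0 sr)); exact: entry_le_norm.
rewrite ler_norml -mulNr; apply/andP; split.
  apply: (primitive1_ge xvi s0 st).
  apply: (@filterS _ _ (ae_filter_ringOfSetsType _)) vM => r /vi + srt.
  by move=> /(_ srt)/andP[].
apply: (primitive1_le xvi s0 st).
apply: (@filterS _ _ (ae_filter_ringOfSetsType _)) vM => r /vi + srt.
by move=> /(_ srt)/andP[].
Qed.

(** * The observer of one output channel *)

(** [Num.sqrt] is 0 on negative numbers, which makes continuity at 0 evident. *)
Lemma sqrt_sgnE (R : realType) (s : R) :
  sqrt_sgn s = Num.sqrt s - Num.sqrt (- s).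
Proof.
have [s0|s0|->] := ltgtP s 0; last by rewrite sqrt_sgn0 oppr0 subrr.
  rewrite -[s in LHS]opprK sqrt_sgnN sqrt_sgn_gt0 ?oppr_gt0 //.
  by rewrite [Num.sqrt s]ler0_sqrtr ?sub0r // ltW.
by rewrite sqrt_sgn_gt0 // [Num.sqrt (- s)]ler0_sqrtr ?subr0 // oppr_le0 ltW.
Qed.

Lemma sqrt_sgn_continuous (R : realType) : continuous (@sqrt_sgn R).
Proof.
rewrite (_ : @sqrt_sgn R = fun s => Num.sqrt s - Num.sqrt (- s)); last first.
  by apply/funext => s; rewrite sqrt_sgnE.
move=> s; apply: (@continuousB _ _ _ Num.sqrt (fun s : R => Num.sqrt (- s))).
  exact: sqrt_continuous.
apply: (@continuous_comp _ _ _ (fun s : R => - s) Num.sqrt).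
  exact: opp_continuous.
exact: sqrt_continuous.
Qed.

Lemma Sign_bound (R : realType) (a s : R) : Sign a s -> -1 <= s <= 1.
Proof.
rewrite /Sign; case: ifP => [_|/negbT a0] /=; first by rewrite in_itv.
by move=> ->; case: sgrP a0 => //; rewrite ?eqxx // => _ _; lra.
Qed.

Lemma Sign_gt0 (R : realType) (a s : R) : 0 < a -> Sign a s -> s = 1.
Proof. by move=> a0; rewrite /Sign gt_eqF //= gtr0_sg. Qed.

Lemma Sign_lt0 (R : realType) (a s : R) : a < 0 -> Sign a s -> s = -1.
Proof. by move=> a0; rewrite /Sign lt_eqF //= ltr0_sg. Qed.

(** w stands for the known input term [C B u]_j: it need not be continuous,
    but it cancels in y - z1, whose velocity is therefore continuous.  The
    bounds on the increments of z2 come from the almost-everywhere values of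
    the selection s. *)
Lemma observer_super_twisting (R : realType) (l k1 k2 M : R)
    (y z1 z2 phi w s : R -> R) : 0 <= l -> 0 <= k2 ->
  primitive1 y (fun t => phi t + w t) ->
  primitive1 z1 (fun t => z2 t + w t + l * k1 * sqrt_sgn (y t - z1 t)) ->
  primitive1 z2 (fun t => l ^+ 2 * k2 * s t) ->
  {ae (@lebesgue_measure R), forall t, 0 <= t -> Sign (y t - z1 t) (s t)} ->
  (forall t, 0 < t -> {for t, continuous phi}) ->
  (forall t r, 0 <= t -> t <= r -> `|phi r - phi t| <= M * (r - t)) ->
  super_twisting (l * k1) (l ^+ 2 * k2 + M) (l ^+ 2 * k2 - M)
    (fun t => y t - z1 t) (fun t => phi t - z2 t).
Proof.
move=> l0 k20 yp z1p z2p sgn cphi lip.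
set m := l ^+ 2 * k2 in z2p *.
have m0 : 0 <= m by rewrite mulr_ge0 ?sqr_ge0.
have ap := primitive1B yp z1p.
have z2_le t r c : 0 < t -> t <= r ->
    {ae (@lebesgue_measure R), forall q, t <= q <= r -> s q <= c} ->
    z2 r - z2 t <= m * c * (r - t).
  move=> t0 tr sc; apply: (primitive1_le z2p (ltW t0) tr).
  apply: (@filterS _ _ (ae_filter_ringOfSetsType _)) sc => q sq /sq.
  by move=> sqc; rewrite ler_wpM2l.
have z2_ge t r c : 0 < t -> t <= r ->
    {ae (@lebesgue_measure R), forall q, t <= q <= r -> c <= s q} ->
    m * c * (r - t) <= z2 r - z2 t.
  move=> t0 tr sc; apply: (primitive1_ge z2p (ltW t0) tr).
  apply: (@filterS _ _ (ae_filter_ringOfSetsType _)) sc => q sq /sq.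
  by move=> sqc; rewrite ler_wpM2l.
have sgnS (t r : R) (Q : R -> Prop) : 0 < t ->
    (forall q, t <= q <= r -> Sign (y q - z1 q) (s q) -> Q q) ->
    {ae (@lebesgue_measure R), forall q, t <= q <= r -> Q q}.
  move=> t0 SQ; apply: (@filterS _ _ (ae_filter_ringOfSetsType _)) sgn => q.
  move=> qS /[dup] /andP[tq _] /SQ; apply; apply: qS.
  by rewrite ltW // (lt_le_trans t0).
split.
- move=> t t0.
  have cz2 : {for t, continuous z2} by exact: primitive1_continuous z2p t0.
  have ca := primitive1_continuous ap t0.
  have ap' : primitive1 (fun t => y t - z1 t)
      (fun t => phi t - z2 t - l * k1 * sqrt_sgn (y t - z1 t)).
    by apply: eq_primitive1 ap => // r _; ring.
  apply: (primitive1_derive ap' t0).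
  apply: (@continuousB _ _ _ (fun t => phi t - z2 t)
    (fun t => l * k1 * sqrt_sgn (y t - z1 t))).
    by apply: continuousB => //; exact: cphi.
  apply: (@continuousM _ _ (fun=> l * k1) (fun t => sqrt_sgn (y t - z1 t))).
    exact: cst_continuous.
  apply: (@continuous_comp _ _ _ (fun t => y t - z1 t) (@sqrt_sgn R)) => //.
  exact: sqrt_sgn_continuous.
- move=> t r t0 tr.
  have := lip t r (ltW t0) tr; rewrite !ler_norml => /andP[p1 p2].
  have := z2_le t r 1 t0 tr (sgnS t r _ t0 _).
  have := z2_ge t r (-1) t0 tr (sgnS t r _ t0 _).
  have hb q : t <= q <= r -> Sign (y q - z1 q) (s q) -> -1 <= s q <= 1.
    by move=> _ /Sign_bound.
  move=> /(_ (fun q h1 h2 => (andP (hb q h1 h2)).1)) u1.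
  move=> /(_ (fun q h1 h2 => (andP (hb q h1 h2)).2)) u2.
  lra.
- move=> t r t0 tr apos.
  have := lip t r (ltW t0) tr; rewrite ler_norml => /andP[p1 p2].
  have := z2_ge t r 1 t0 tr (sgnS t r _ t0 _).
  have hb q : t <= q <= r -> Sign (y q - z1 q) (s q) -> 1 <= s q.
    by move=> /apos aq /(Sign_gt0 aq) ->.
  move=> /(_ hb); lra.
- move=> t r t0 tr aneg.
  have := lip t r (ltW t0) tr; rewrite ler_norml => /andP[p1 p2].
  have := z2_le t r (-1) t0 tr (sgnS t r _ t0 _).
  have hb q : t <= q <= r -> Sign (y q - z1 q) (s q) -> s q <= -1.
    by move=> /aneg aq /(Sign_lt0 aq) ->.
  move=> /(_ hb); lra.
Qed.
(** * The plant *)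

Lemma plant_velocity_bound (R : realType) (n nu : nat) (A W : 'M[R]_n)
    (B : 'M[R]_(n, nu)) (f : 'cV[R]_n -> 'cV[R]_n) (k ubar : R)
    (Kset : set 'cV[R]_n) :
  0 <= k -> (forall x y, `|f x - f y| <= k * `|x - y|) -> compact Kset ->
  exists2 M : R, 0 <= M & forall x u, Kset x -> enorm u <= ubar ->
    `|A *m x + W *m f x + B *m u| <= M.
Proof.
move=> k0 flip cK.
have [c c0 Kc] : exists2 c, 0 < c & forall x, Kset x -> `|x| <= c.
  have [c c0 Kc] := pinfty_ex_gt0 (compact_bounded cK).
  by exists c => // x Kx; exact: Kc.
exists (entry_sum A * c + entry_sum W * (k * c + `|f 0|) +
        entry_sum B * `|ubar|).
  by rewrite !addr_ge0 ?mulr_ge0 ?entry_sum_ge0 ?addr_ge0 ?mulr_ge0 // ltW.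
move=> x u /Kc xc uu.
have un : `|u| <= `|ubar|.
  apply: norm_le_entries => // i j; rewrite (ord1 j).
  apply: le_trans (le_trans uu (ler_norm _)).
  rewrite -sqrtr_sqr /enorm ler_wsqrtr // (bigD1 i) //= lerDl.
  by apply: sumr_ge0 => r _; rewrite sqr_ge0.
have fn : `|f x| <= k * c + `|f 0|.
  rewrite -[f x](subrK (f 0)) (le_trans (ler_normD _ _)) // lerD2r.
  by apply: le_trans (flip _ _) _; rewrite subr0 ler_wpM2l.
apply: le_trans (ler_normD _ _) _; apply: lerD.
  apply: le_trans (ler_normD _ _) _; apply: lerD;
    by apply: le_trans (mulmx_norm_le _ _) _; rewrite ler_wpM2l ?entry_sum_ge0.
by apply: le_trans (mulmx_norm_le _ _) _; rewrite ler_wpM2l ?entry_sum_ge0.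
Qed.

(** The input terms of x and xh may be discontinuous; only the difference g of
    the two velocities has to be continuous. *)
Lemma primitive_error_derive (R : realType) (n : nat)
    (x xh v vh g : R -> 'cV[R]_n) (t : R) (i : 'I_n) :
  primitive x v -> primitive xh vh -> (forall s, vh s - v s = g s) -> 0 < t ->
  {for t, continuous g} ->
  is_derive t 1 (fun s => (xh s - x s) i ord0) (g t i ord0).
Proof.
move=> xv xhv gE t0 cg.
apply: (@primitive1_derive _ _ (fun s => g s i ord0)) => //; last first.
  exact: entry_continuous.
apply: eq_primitive1
  (primitive1B (primitive1_entry i xhv) (primitive1_entry i xv)).
  by move=> s _; rewrite !mxE.
by move=> s _; rewrite -gE !mxE.
Qed.

(** x is Lipschitz in time because its velocity is bounded almost everywhere,
    and f is Lipschitz, so the rate of C A x + C W f x is bounded without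
    differentiating f along the trajectory.  M depends on
    the compact set and on the bound of the inputs only, so it is available
    before the observer gains are chosen. *)
Lemma output_drift_lipschitz (R : realType) (n nu ny : nat) (A W : 'M[R]_n)
    (B : 'M[R]_(n, nu)) (C : 'M[R]_(ny, n)) (f : 'cV[R]_n -> 'cV[R]_n)
    (U : set (R -> 'cV[R]_nu)) (X0 Kset : set 'cV[R]_n) :
  [lipschitz f x | x in [set: 'cV[R]_n]] ->
  (exists ubar : R, forall u, U u ->
     {ae (@lebesgue_measure R), forall t, 0 <= t -> enorm (u t) <= ubar}) ->
  compact Kset ->
  (forall u x, U u -> X0 (x 0) -> plant_solution A W B f u x ->
     forall t, 0 <= t -> Kset (x t)) ->
  exists2 M : R, 0 <= M & forall u x, U u -> X0 (x 0) ->
    plant_solution A W B f u x -> forall j t r, 0 <= t -> t <= r ->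
    `|(C *m A *m x r + C *m W *m f (x r)) j ord0 -
      (C *m A *m x t + C *m W *m f (x t)) j ord0| <= M * (r - t).
Proof.
move=> /lipschitz_bound[k k0 flip] [ubar Ubar] cK stay.
have [V V0 velocity] := plant_velocity_bound A W B ubar k0 flip cK.
exists ((entry_sum (C *m A) + entry_sum (C *m W) * k) * V).
  by rewrite mulr_ge0 ?addr_ge0 ?mulr_ge0 ?entry_sum_ge0.
move=> u x Uu X0x plant j t r t0 tr.
have xlip : `|x r - x t| <= V * (r - t).
  apply: (primitive_lipschitz V0 plant) => //.
  apply: (@filterS _ _ (ae_filter_ringOfSetsType _)) (Ubar u Uu) => h uh h0.
  by apply: velocity (uh h0); exact: stay plant _ h0.
have mxB (a b : 'cV[R]_ny) : a j ord0 - b j ord0 = (a - b) j ord0.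
  by rewrite !mxE.
rewrite mxB.
apply: le_trans (entry_le_norm _ _ _) _.
have -> : C *m A *m x r + C *m W *m f (x r) -
    (C *m A *m x t + C *m W *m f (x t)) =
    C *m A *m (x r - x t) + C *m W *m (f (x r) - f (x t)).
  by rewrite !mulmxBr opprD addrACA.
rewrite -mulrA mulrDl; apply: le_trans (ler_normD _ _) (lerD _ _).
  by apply: le_trans (mulmx_norm_le _ _) _; rewrite ler_wpM2l ?entry_sum_ge0.
apply: le_trans (mulmx_norm_le _ _) _.
rewrite -mulrA ler_wpM2l ?entry_sum_ge0 //.
by apply: le_trans (flip _ _) _; rewrite ler_wpM2l.
Qed.

(** * The theorem *)

Theorem theorem6 (R : realType) (n nu ny : nat) (hn : (0 < n)%N)
  (A W : 'M[R]_n) (B : 'M[R]_(n, nu)) (C : 'M[R]_(ny, n))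
  (f : 'cV[R]_n -> 'cV[R]_n)
  (f_C1 : C1 f) (f_lip : [lipschitz f x | x in [set: 'cV[R]_n]])
  (gamma : 'rV[R]_n) (hgamma : psd (diag_mx gamma))
  (* inputs and initial states under consideration *)
  (U : set (R -> 'cV[R]_nu)) (X0 : set 'cV[R]_n)
  (U_L2 : forall u, U u -> L2_input u)
  (U_bounded : exists ubar : R, forall u, U u ->
     {ae (@lebesgue_measure R), forall t, 0 <= t -> enorm (u t) <= ubar})
  (Kset : set 'cV[R]_n) (Kset_compact : compact Kset)
  (stay : forall u x, U u -> X0 (x 0) -> plant_solution A W B f u x ->
     forall t, 0 <= t -> Kset (x t))
  (P : 'M[R]_n) (hP : pd P)
  (lambda : 'rV[R]_n) (hlambda : pd (diag_mx lambda))
  (hsector : incremental_sector f gamma lambda)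
  (q : R) (hq : 0 < q)
  (K K' E : 'M[R]_(n, ny))
  (hLMI : nsd (LMI_matrix A W C gamma lambda P q K K' E)) :
  exists (k1 k2 : R) (Lstar : 'I_ny -> R),
    [/\ 0 < k1, 0 < k2, (forall j, 1 <= Lstar j) &
    forall L : 'I_ny -> R, (forall j, Lstar j <= L j) ->
    forall (u : R -> 'cV[R]_nu) (x : R -> 'cV[R]_n),
      U u -> X0 (x 0) -> plant_solution A W B f u x ->
    let y := fun t => C *m x t in
    forall z1 z2 : R -> 'cV[R]_ny,
      homogeneous_observer B C k1 k2 L u y z1 z2 ->
    exists T0 : R,
      [/\ 0 < T0,
          (forall t, T0 <= t -> z2 t = C *m A *m x t + C *m W *m f (x t)) &
      forall xh : R -> 'cV[R]_n,
        state_observer A W B C f K K' E u y z2 xh ->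
      let e := fun t => xh t - x t in
      let kappaP := Num.sqrt (lambda_max P / lambda_min P) in
      let rho := q / (2 * lambda_max P) in
      forall t, T0 <= t ->
        enorm (e t) <= kappaP * expR (- rho * (t - T0)) * enorm (e T0)]].
Proof.
have cf : continuous f.
  by move=> x; apply: differentiable_continuous; exact: f_C1.1.
have [M M0 drift] := output_drift_lipschitz C f_lip U_bounded Kset_compact stay.
(* with these gains overdamping reads L^2 + M <= 2 L^2, and M < L^2 makes the
   sign term win over the drift of phi *)
exists 4, 1, (fun=> M + 1); split => //; first by move=> j; rewrite lerDr.
move=> L LM u x Uu X0x plant y z1 z2 [z1p [s [sS z2p]]].
pose phi t := C *m A *m x t + C *m W *m f (x t).
have cx t : 0 < t -> {for t, continuous x}.
  exact: primitive_curve_continuous plant.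
have cfx t : 0 < t -> {for t, continuous (f \o x)}.
  by move=> t0; apply: continuous_comp; [exact: cx | exact: cf].
have cphi t : 0 < t -> {for t, continuous phi}.
  move=> t0; exact (curve_continuousD
    (mulmx_curve_continuous (C *m A) (cx t t0))
    (mulmx_curve_continuous (C *m W) (cfx t t0))).
have yp := primitive_mulmx C plant.
have finite_time j :
    exists2 T, 0 < T & forall t, T <= t -> phi t j ord0 - z2 t j ord0 = 0.
  have Lj : M + 1 <= L j by exact: LM.
  have L1 : 1 <= L j by rewrite (le_trans _ Lj) // lerDr.
  have L2 : M + 1 <= L j ^+ 2.
    by apply: le_trans Lj _; rewrite expr2 ler_peMl // (le_trans ler01).
  apply: (@super_twisting_finite_time R (L j * 4) (L j ^+ 2 * 1 + M)
    (L j ^+ 2 * 1 - M) _ _ _ (fun t => y t j ord0 - z1 t j ord0)).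
  - lra.
  - lra.
  - by rewrite exprMn; lra.
  apply: (@observer_super_twisting R (L j) 4 1 M (fun t => y t j ord0)
    (fun t => z1 t j ord0) (fun t => z2 t j ord0) (fun t => phi t j ord0)
    (fun t => (C *m B *m u t) j ord0) (fun t => s t j ord0)) => //.
  - lra.
  - apply: eq_primitive1 (primitive1_entry j yp) => // t _.
    by rewrite !mulmxDr !mulmxA /phi !mxE.
  - by apply: eq_primitive1 (primitive1_entry j z1p) => // t _; rewrite mxE.
  - by apply: eq_primitive1 (primitive1_entry j z2p) => // t _; rewrite mxE.
  - by apply: (@filterS _ _ (ae_filter_ringOfSetsType _)) sS => t sSt /sSt.
  - by move=> t t0; apply: entry_continuous; exact: cphi.
  - exact: (drift u x Uu X0x plant j).
have [T T_gt0 Tphi] := fin_all_exists2 finite_time.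
(* any time beyond all the T j; the 1 keeps it positive when ny = 0 *)
exists (1 + \sum_j T j).
set T0 := 1 + _.
have T00 : 0 < T0 by rewrite ltr_pwDl // sumr_ge0 // => j _; rewrite ltW.
have z2E t : T0 <= t -> z2 t = phi t.
  move=> T0t; apply/colP => j; apply/esym/eqP.
  rewrite -subr_eq0; apply/eqP/Tphi.
  apply: le_trans T0t; rewrite /T0 (bigD1 j) //= addrCA lerDl addr_ge0 //.
  by rewrite sumr_ge0 // => i _; rewrite ltW.
split => // xh obs e kappaP rho.
pose zeta t := xh t + E *m (y t - C *m xh t).
pose g t := A *m e t + W *m (f (zeta t) - f (x t)) + K *m (y t - C *m xh t)
  - K' *m (C *m A *m xh t + C *m W *m f (zeta t) - z2 t).
have gE t : A *m xh t + W *m f (zeta t) + K *m (y t - C *m xh t)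
    - K' *m (C *m A *m xh t + C *m W *m f (zeta t) - z2 t) + B *m u t
    - (A *m x t + W *m f (x t) + B *m u t) = g t.
  rewrite /g /e !(mulmxBr _ (xh t)) !(mulmxBr _ (f _)).
  move: (A *m xh t) (W *m f (zeta t)) (K *m _) (K' *m _) (B *m u t) (A *m x t)
    (W *m f (x t)) => a1 a2 a3 a4 a5 a6 a7.
  by apply/colP => i; rewrite !mxE; ring.
have cg t : 0 < t -> {for t, continuous g}.
  move=> t0.
  have cxt := cx t t0.
  have cxh : {for t, continuous xh} by exact: primitive_curve_continuous obs t0.
  have cz2 : {for t, continuous z2} by exact: primitive_curve_continuous z2p t0.
  have cCxh := mulmx_curve_continuous C cxh.
  have cinn := curve_continuousB (mulmx_curve_continuous C cxt) cCxh.
  have cze := curve_continuousD cxh (mulmx_curve_continuous E cinn).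
  have cfz : {for t, continuous (fun t => f (zeta t))}.
    exact: (@continuous_comp _ _ _ zeta f _ cze (cf _)).
  have cdf := curve_continuousB cfz (cfx t t0).
  have cpred := curve_continuousD (mulmx_curve_continuous (C *m A) cxh)
    (mulmx_curve_continuous (C *m W) cfz).
  exact (curve_continuousB (curve_continuousD (curve_continuousD
    (mulmx_curve_continuous A (curve_continuousB cxh cxt))
    (mulmx_curve_continuous W cdf)) (mulmx_curve_continuous K cinn))
    (mulmx_curve_continuous K' (curve_continuousB cpred cz2))).
apply: (@lyapunov_decay R n P q T0 e g) => // t T0t.
  move=> i; have t0 := lt_le_trans T00 T0t.
  exact: (primitive_error_derive i plant obs gE t0 (cg t t0)).
have zx : zeta t - x t = (1%:M - E *m C) *m e t.
  rewrite /zeta /y /e mulmxBl mul1mx !mulmxBr !mulmxA.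
  move: (xh t) (x t) (E *m C *m _) (E *m C *m _) => a1 a2 a3 a4.
  by apply/colP => i; rewrite !mxE; ring.
have gclosed : g t = ((1%:M - K' *m C) *m A - K *m C) *m e t
    + (1%:M - K' *m C) *m W *m (f (zeta t) - f (x t)).
  rewrite /g (z2E t T0t) /phi /y.
  have -> : C *m x t - C *m xh t = - (C *m e t) by rewrite /e mulmxBr opprB.
  have -> : C *m A *m xh t + C *m W *m f (zeta t) -
      (C *m A *m x t + C *m W *m f (x t)) =
      C *m A *m e t + C *m W *m (f (zeta t) - f (x t)).
    by rewrite /e !mulmxBr opprD addrACA.
  move: (e t) (f (zeta t) - f (x t)) => e0 d0.
  rewrite mulmxN !mulmxDr !mulmxBl !mul1mx !mulmxA.
  move: (A *m e0) (W *m d0) (K *m C *m e0) (K' *m C *m A *m e0)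
    (K' *m C *m W *m d0) => a1 a2 a3 a4 a5.
  by apply/colP => i; rewrite !mxE; ring.
rewrite gclosed; apply: (lmi_dissipation hLMI).
by have := hsector (x t) (zeta t); rewrite /= zx.
Qed.
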